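(* Let $\mathcal R$ denote the set of partitions in which any two parts differ by at least 2, and let $A_{7,2}(n)$ denote the number of partitions of $n$ into parts $\not\equiv 0,\pm2\pmod 7$. Then, for every $n\ge 0$, $$A_{7,2}(n)=\sum_{\tilde\pi\in\mathcal R,\ \sigma(\tilde\pi)=n}\omega_6(\tilde\pi),$$ where $\omega_6(\tilde\pi)$ is the product of Fibonacci-number weights of the strings of $\tilde\pi$ defined in the context.
   Context: For a partition $\pi$, $\sigma(\pi)$ denotes the sum of its parts. The Fibonacci numbers are $F_0=0$, $F_1=1$, $F_n=F_{n-1}+F_{n-2}$ for $n\ge2$. Given $\tilde\pi\in\mathcal R$, a string $\psi$ in $\tilde\pi$ is a maximal sequence of parts of $\tilde\pi$ in which the difference between consecutive parts is $\le 3$ (so every such difference is 2 or 3, and distinct strings are separated by gaps $\ge4$). Every $\tilde\pi\in\mathcal R$ decomposes uniquely into strings. For a string $\psi$, let $\eta=\eta(\psi)$ be the number of gaps (differences between consecutive parts) in $\psi$ equal to 3. Writing $j\in\psi$ to mean that $j$ is a part in $\psi$, the weight of $\psi$ is $$\omega_6(\psi)=\begin{cases}F_{\eta+3},&\text{if all parts of }\psi\text{ are}\ge3,\\ F_{\eta+2},&\text{if either }(1\in\psi,\ 3\notin\psi\text{ and }4\notin\psi)\text{ or }2\in\psi,\\ F_{\eta+1},&\text{if }1\in\psi\text{ and either }3\in\psi\text{ or }4\in\psi.\end{cases}$$ The weight of $\tilde\pi$ is $\omega_6(\tilde\pi)=\prod_{\psi}\omega_6(\psi)$, the product over all strings $\psi$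 of $\tilde\pi$ (the empty product is 1). *)

(* Defs.v *)
From HB Require Import structures.
From mathcomp Require Import all_boot.

Set Implicit Arguments.
Unset Strict Implicit.
Unset Printing Implicit Defensive.

Fixpoint fib (n : nat) : nat :=
  match n with
  | 0 => 0
  | 1 => 1
  | (m.+1 as k).+1 => fib k + fib m
  end.

(* The parts are listed in nonincreasing order. *)
Definition is_intpart (n : nat) (p : seq nat) : bool :=
  [&& sorted geq p, all (fun i => 0 < i) p & sumn p == n].

Record intpart (n : nat) : Type :=
  IntPart { parts :> seq nat; intpartP : is_intpart n parts }.

HB.instance Definition _ n := [isSub for @parts n].
HB.instance Definition _ n := [Countable of intpart n by <:].

Lemma leq_sumn_mem (s : seq nat) (i : nat) : i \in s -> i <= sumn s.
Proof.
elim: s => //= j s IHs; rewrite inE => /predU1P[-> | /IHs les].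
  exact: leq_addr.
exact: leq_trans les (leq_addl _ _).
Qed.

Lemma size_intpart n (p : intpart n) : size p <= n.
Proof.
case: p => p /= /and3P[_ p_gt0 /eqP <-].
elim: p p_gt0 => //= i p IHp /andP[i_gt0 /IHp lep].
by rewrite -add1n leq_add.
Qed.

(* A partition of n has at most n parts, each of size at most n. *)
Definition bseq_of_intpart n (p : intpart n) : n.-bseq 'I_n.+1 :=
  insub_bseq n [seq inord i | i <- parts p].

Definition intpart_of_bseq n (b : n.-bseq 'I_n.+1) : option (intpart n) :=
  insub [seq val i | i <- b].

Lemma bseq_of_intpartK n : pcancel (@bseq_of_intpart n) (@intpart_of_bseq n).
Proof.
move=> p; rewrite /intpart_of_bseq /bseq_of_intpart.
rewrite /insub_bseq val_insubd size_map size_intpart -map_comp.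
rewrite map_id_in ?valK // => i pi /=; rewrite inordK // ltnS.
by have /and3P[_ _ /eqP <-] := intpartP p; apply: leq_sumn_mem.
Qed.

HB.instance Definition _ n : isFinite (intpart n) :=
  PCanIsFinite (@bseq_of_intpartK n).

Definition A72 (n : nat) : nat :=
  #|[set p : intpart n | all (fun i => i %% 7 \notin [:: 0; 2; 5]) p]|.

(* Truncated subtraction is the true difference, as the earlier part of a
   nonincreasing sequence is the larger one. *)
Definition inR (p : seq nat) : bool := pairwise (fun i j => 2 <= i - j) p.

Definition gaps (s : seq nat) : seq nat :=
  [seq ij.1 - ij.2 | ij <- zip s (behead s)].

(* The nonempty blocks of consecutive entries of p, one for each position; in
   particular the empty partition has no string. *)
Definition blocks (p : seq nat) : seq (seq nat) :=
  [seq take k (drop i p) | i <- iota 0 (size p), k <- iota 1 (size p - i)].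

Definition chain3 (s : seq nat) : bool := all (fun d => d <= 3) (gaps s).

Definition is_string (p psi : seq nat) : bool :=
  chain3 psi &&
  all (fun phi => chain3 phi && infix psi phi ==> (phi == psi)) (blocks p).

Definition strings (p : seq nat) : seq (seq nat) :=
  [seq psi <- blocks p | is_string p psi].

Definition eta3 (psi : seq nat) : nat := count_mem 3 (gaps psi).

(* In a string of a partition in R the last branch is exactly the case where
   1 is a part and 3 or 4 is a part: 2 cannot occur together with 1. *)
Definition string_weight6 (psi : seq nat) : nat :=
  if all (fun i => 3 <= i) psi then fib (eta3 psi + 3)
  else if [&& 1 \in psi, 3 \notin psi & 4 \notin psi] || (2 \in psi)
  then fib (eta3 psi + 2)
  else fib (eta3 psi + 1).

Definition weight6 (p : seq nat) : nat :=
  \prod_(psi <- strings p) string_weight6 psi.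

Lemma mem_blocks (p s : seq nat) :
  (s \in blocks p) = (s != [::]) && infix s p.
Proof.
apply/allpairsPdep/andP => [[i [k [+ + ->]]]|[s_neq0 /infixP[s1 [s2 ->]]]].
  rewrite !mem_iota !add0n add1n ltnS /= => lti /andP[k_gt0 lek].
  split; first by rewrite -size_eq0 size_takel ?size_drop // -lt0n.
  apply/infixP; exists (take i p), (drop k (drop i p)).
  by rewrite !cat_take_drop.
exists (size s1), (size s); rewrite !mem_iota !size_cat drop_size_cat //.
rewrite take_size_cat // add1n ltnS addKn leq_addr !add0n /=.
by have := s_neq0; rewrite -size_eq0 -lt0n => s_gt0; split;
   rewrite ?s_gt0 // -addn1 leq_add2l (leq_trans s_gt0) ?leq_addr.
Qed.

Lemma stringsP (p psi : seq nat) :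
  reflect [/\ psi <> [::], infix psi p, chain3 psi
            & forall phi, infix phi p -> chain3 phi -> infix psi phi ->
                phi = psi]
          (psi \in strings p).
Proof.
rewrite mem_filter mem_blocks /is_string.
apply: (iffP idP) => [/andP[/andP[c3 /allP pmax] /andP[/eqP n0 ip]]|].
  split=> // phi iphi cphi ipp; apply/eqP.
  have phi0 : phi != [::].
    by case: phi ipp {iphi cphi} => //; case: psi n0 {c3 pmax ip}.
  have := pmax phi; rewrite mem_blocks phi0 iphi => /(_ isT).
  by rewrite cphi ipp.
case=> /eqP-> -> -> pmax; rewrite !andbT /=; apply/allP => phi.
rewrite mem_blocks => /andP[_ iphi]; apply/implyP => /andP[cphi ipp].
by rewrite (pmax phi).
Qed.

(* Main.v *)
Require Import Defs.
From mathcomp Require Import all_boot.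
From mathcomp Require Import all_algebra qpoly zify ring.

Set Implicit Arguments.
Unset Strict Implicit.
Unset Printing Implicit Defensive.

Import GRing.Theory Num.Theory.

(** The weights are counts, and the counts form a product.

Call run a maximal sequence of parts of a partition in R whose consecutive
differences are all 2.  A string with eta gaps equal to 3 consists of eta + 1
runs, and F_(m+2) is the number of 0/1 words of length m without two adjacent
ones.  So the weight of a partition is the number of its markings: sets of runs
such that two marked runs are never at distance 3, such that a run ending in 1
is marked and such that a run ending in 2 is not ([weight6_nmarkings]).

Subtract the staircase 1, 3, 5, ... from the N parts, smallest first.  This
removes N^2 and leaves an arbitrary multiset of N natural numbers; runs become
repeated values, and gaps of 3 become consecutive values.  The value 0 is
marked as soon as it is present; the value 1 never is, as its run is next to a
marked one or ends in 2.  So a marking is a set K of present values that are at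
least 2, no two of them consecutive, and taking out one copy of each element of
K leaves an arbitrary multiset.  The sets K of
size k have generating function q^(k^2+k)/(q)_k, with (q)_k = (1-q)...(1-q^k),
and the multisets of size N-k have 1/(q)_(N-k).  Hence ([staircases_gf]) the
weighted sum has the generating function

   sum over N, k of q^(N^2+k^2+k) / ((q)_k (q)_(N-k)),

one of the Andrews-Gordon series for the modulus 7.  Bailey's lemma
([bailey_lemma]), applied twice with parameter q and once with parameter 1 to
the unit Bailey pair, turns the series into 1/(q)_oo times the theta series
sum over integers r of (-1)^r q^((7r^2+3r)/2).  By Jacobi's triple product
([finite_jacobi]) this theta series is the product of all 1 - q^i with
i = 0, 2, 5 modulo 7, which leaves the generating function of A_(7,2)
([andrews_gordon_product]).

Only the coefficient of q^n matters, so q is taken in Z[X]/(X^(n+1)).  There q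
is nilpotent: every 1 - q^i with i > 0 is invertible, all series are finite
sums, and an infinite product is the value of a finite one that is long
enough. *)

(** * Gaussian binomials and Bailey's lemma *)

Section QBinomial.
Local Open Scope ring_scope.
Variables (R : comNzRingType) (q : R).

Fixpoint qbin (m k : nat) : R :=
  match m, k with
  | _, 0 => 1
  | 0, _.+1 => 0
  | m'.+1, k'.+1 => qbin m' k' + q ^+ k'.+1 * qbin m' k'.+1
  end.

Lemma qbin0 m : qbin m 0 = 1. Proof. by case: m. Qed.

Lemma qbinS m k : qbin m.+1 k.+1 = qbin m k + q ^+ k.+1 * qbin m k.+1.
Proof. by []. Qed.

Lemma qbin_small m k : (m < k)%N -> qbin m k = 0.
Proof.
elim: m k => [|m IHm] [|k] //= mk.
by rewrite !IHm ?mulr0 ?addr0 // ltnW.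
Qed.

Lemma qbinn m : qbin m m = 1.
Proof. by elim: m => //= m ->; rewrite qbin_small // mulr0 addr0. Qed.

Lemma qbinSr m k : (k <= m)%N ->
  qbin m.+1 k.+1 = qbin m k.+1 + q ^+ (m - k) * qbin m k.
Proof.
elim: m k => [|m IHm] k.
  by rewrite leqn0 => /eqP->; rewrite /= mulr0 addr0 add0r expr0 mulr1.
case: (ltngtP k m.+1) => // [km _|-> _].
  rewrite [LHS]qbinS [X in q ^+ k.+1 * X](IHm k) // [X in _ = X + _]qbinS.
  case: k km => [|k] km.
    rewrite !qbin0 !subn0 !mulr1 expr1 (exprS q m). ring.
  rewrite [X in X + _ = _](IHm k) 1?ltnW // [X in _ = _ + _ * X]qbinS subSS.
  have [d ->] : exists d, m = (d + k.+1)%N by exists (m - k.+1)%N; rewrite subnK.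
  have -> : ((d + k.+1) - k = d.+1)%N by lia.
  rewrite addnK !exprS. ring.
by rewrite subnn expr0 mul1r qbinn [qbin _.+1 _]qbin_small // add0r qbinn.
Qed.

Arguments qbin : simpl never.

(* e m plays the role of 1 / ((1 - q) (1 - q^2) ... (1 - q^m)). *)
Variable e : nat -> R.
Hypotheses (e0 : e 0 = 1) (eS : forall m, e m.+1 * (1 - q ^+ m.+1) = e m).

Definition qpoch m : R := \prod_(i < m) (1 - q ^+ i.+1).

Lemma qpochK m : qpoch m * e m = 1.
Proof.
elim: m => [|m IHm]; first by rewrite /qpoch big_ord0 e0 mulr1.
by rewrite /qpoch big_ord_recr /= -mulrA [_ * e _]mulrC eS.
Qed.

Lemma mulr_1subX_inj m : injective (fun x => x * (1 - q ^+ m.+1)).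
Proof.
move=> x y /= /(congr1 (fun z => z * (e m.+1 * qpoch m))).
rewrite -!mulrA !(mulrA (1 - _) (e _)) [(1 - _) * e _]mulrC eS.
by rewrite [e m * _]mulrC qpochK !mulr1.
Qed.

Lemma mulr_e_inj m : injective (fun x => x * e m).
Proof.
move=> x y /= /(congr1 (fun z => z * qpoch m)).
by rewrite -!mulrA [e m * _]mulrC qpochK !mulr1.
Qed.

(** The Gaussian binomial is (q)_(k+l) / ((q)_k (q)_l): both sides satisfy the
Pascal recurrence. *)
Lemma qbin_quotient k l : qbin (k + l) k * e (k + l) = e k * e l.
Proof.
elim: k l => [|k IHk] l; first by rewrite qbin0 e0.
elim: l => [|l IHl]; first by rewrite addn0 qbinn e0 mul1r mulr1.
apply: (@mulr_1subX_inj (k + l).+1) => /=.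
have IHl' : qbin (k + l).+1 k.+1 * e (k + l).+1 = e k.+1 * e l by rewrite -addSn.
have IHk' : qbin (k + l).+1 k * e (k + l).+1 = e k * e l.+1 by rewrite -addnS.
rewrite addSn addnS -mulrA eS qbinS mulrDl -mulrA IHl' IHk' -(eS k) -(eS l).
rewrite !exprS exprD; ring.
Qed.

(** The limit c -> oo of the q-Vandermonde formula for a Gaussian binomial
[m + c; m + b].  Splitting qbin m.+1 t by Pascal's rule and writing e (t + b) as
e (t + b).+1 times its last factor, two of the three resulting sums cancel, and
the sum for (m.+1, b) becomes the one for (m, b.+1). *)
Lemma q_vandermonde m b :
  \sum_(t < m.+1) q ^+ (t * t + t * b) * qbin m t * e (t + b) = e (m + b).
Proof.
elim: m b => [|m IHm] b; first by rewrite big_ord1 qbin0 !mul1r.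
rewrite addSnnS -IHm.
rewrite big_ord_recl /= mul0n expr0 !mul1r add0n.
transitivity (e b + \sum_(i < m.+1)
     (q ^+ (i.+1 * i.+1 + i.+1 * b) * qbin m i * e (i.+1 + b)
      + q ^+ (i.+1 * i.+1 + i.+1 * b.+1) * qbin m i.+1 * e (i.+1 + b))).
  congr (_ + _); apply: eq_bigr => i _; rewrite /bump /= add1n qbinS (mulnS _ b).
  rewrite !exprD; ring.
rewrite big_split /= addrCA.
pose f i := q ^+ (i * i + i * b.+1) * qbin m i * e (i + b).
have -> : e b + \sum_(i < m.+1)
    q ^+ (i.+1 * i.+1 + i.+1 * b.+1) * qbin m i.+1 * e (i.+1 + b)
  = \sum_(i < m.+1) f i.
  transitivity (\sum_(i < m.+2) f i).
    by rewrite [RHS]big_ord_recl /f /= mul0n expr0 qbin0 !mul1r.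
  by rewrite big_ord_recr /= {2}/f qbin_small // mulr0 mul0r addr0.
rewrite -big_split /=; apply: eq_bigr => i _; rewrite /f addSn addnS -(eS (i + b)).
have -> : (i.+1 * i.+1 + i.+1 * b = i * i + i * b.+1 + (i + b).+1)%N by nia.
rewrite exprD; ring.
Qed.

Lemma bailey_kernel m b :
  \sum_(t < m.+1) q ^+ (t * t + t * b) * e (m - t) * e t * e (t + b)
  = e m * e (m + b).
Proof.
rewrite -q_vandermonde mulr_sumr; apply: eq_bigr => t _.
have := qbin_quotient t (m - t); rewrite subnKC -1?ltnS // => E.
rewrite -!mulrA (mulrA (e (m - t))) [e (m - t) * _]mulrC -E; ring.
Qed.

(** Bailey's lemma for the parameter a = q^b, in the limit where its two free
parameters are infinite.  Bailey pairs are written with the denominators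
(q)_(s-r) (q)_(s+r+b); exchanging the sums leaves [bailey_kernel], in the
variable s - r. *)
Lemma bailey_lemma b (alpha beta : nat -> R) :
  (forall s, beta s = \sum_(r < s.+1) alpha r * e (s - r) * e (s + r + b)) ->
  forall n, \sum_(s < n.+1) q ^+ (s * s + b * s) * e (n - s) * beta s
    = \sum_(r < n.+1)
        (alpha r * q ^+ (r * r + b * r)) * e (n - r) * e (n + r + b).
Proof.
move=> betaE n.
transitivity (\sum_(r < n.+1) \sum_(s < n.+1 | (r <= s)%N)
   q ^+ (s * s + b * s) * e (n - s) * (alpha r * e (s - r) * e (s + r + b))).
  rewrite (exchange_big_dep xpredT) //=; apply: eq_bigr => s _.
  rewrite betaE mulr_sumr (big_ord_widen_cond n.+1 xpredT
    (fun r => q ^+ (s * s + b * s) * e (n - s)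
                * (alpha r * e (s - r) * e (s + r + b)))) //.
apply: eq_bigr => r _.
have rn : (r <= n)%N by rewrite -ltnS.
have -> : (n + r + b = (n - r) + (r + r + b))%N by lia.
rewrite -mulrA -bailey_kernel -(big_geq_mkord _ _ xpredT (fun s =>
   q ^+ (s * s + b * s) * e (n - s) * (alpha r * e (s - r) * e (s + r + b)))).
rewrite -{1}[nat_of_ord r]add0n big_addn big_mkord subSn // mulr_sumr.
apply: eq_bigr => t _; rewrite addnK -subnDA [(r + t)%N]addnC.
have -> : ((t + r) * (t + r) + b * (t + r)
  = r * r + b * r + (t * t + t * (r + r + b)))%N by nia.
rewrite exprD !addnA; ring.
Qed.

(** The unit Bailey pair for a = q, whose beta is 1 at 0 and vanishes
elsewhere. *)
Definition unit_alpha r : R := (-1) ^+ r * q ^+ 'C(r, 2) * (1 - q ^+ r.*2.+1).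

(** The sum that defines beta telescopes. *)
Lemma unit_partial_sum s k : (k < s)%N ->
  (\sum_(r < k.+1) unit_alpha r * e (s - r) * e (s + r + 1)) * (1 - q ^+ s)
  = (-1) ^+ k * q ^+ 'C(k.+1, 2) * (1 - q ^+ k.+1) * e (s - k.+1) * e (s + k.+1).
Proof.
elim: k => [|k IHk] ks.
  rewrite big_ord1 /unit_alpha expr0 bin0n expr0 !mul1r expr1 subn0 addn0 !addn1.
  case: s ks => // s _; rewrite subSS subn0 -(eS s); ring.
rewrite big_ord_recr /= mulrDl IHk 1?ltnW // /unit_alpha.
have [d ->] : exists d, s = (d + k.+2)%N by exists (s - k.+2)%N; rewrite subnK.
have -> : (d + k.+2 - k.+1 = d.+1)%N by lia.
rewrite addnK addn1 -addnS.
have -> : (d + k.+2 + k.+1 = (d + k.*2).+3)%N by lia.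
have -> : (d + k.+2 + k.+2 = (d + k.*2).+4)%N by lia.
rewrite -(eS d) -(eS (d + k.*2).+3) (binS k.+1 1) bin1 -!addnn.
rewrite ?(addSn, addnS, exprS, exprD). ring.
Qed.

Lemma unit_bailey_pair s :
  (s == 0)%:R = \sum_(r < s.+1) unit_alpha r * e (s - r) * e (s + r + 1).
Proof.
case: s => [|s].
  rewrite big_ord1 /unit_alpha expr0 bin0n expr0 !mul1r subn0 addn0 add0n e0 mulr1.
  by rewrite mulrC eS e0.
apply: (@mulr_1subX_inj s).
rewrite /= mul0r big_ord_recr /= mulrDl unit_partial_sum //.
rewrite !subnn e0 !mulr1 addn1 -(eS (s.+1 + s.+1)) /unit_alpha -addnn -addSn.
rewrite (exprS (-1)). ring.
Qed.
End QBinomial.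
Arguments qbin : simpl never.

(** * The Andrews-Gordon series as a theta series *)

Section Chain.
Local Open Scope ring_scope.
Variables (R : comNzRingType) (q : R) (e : nat -> R).
Hypotheses (e0 : e 0 = 1) (eS : forall m, e m.+1 * (1 - q ^+ m.+1) = e m).

Definition delay (c : nat -> R) (r : nat) : R :=
  if r is r'.+1 then c r' else 0.

(** Passing from a Bailey pair for a = q to one for a = 1 with the same beta:
1 - q^(2r+1) = (1 - q^(n+r+1)) - q^(2r+1) (1 - q^(n-r)), and each of the two
factors on the right cancels against a denominator. *)
Lemma change_of_parameter (c : nat -> R) n :
  \sum_(r < n.+1) c r * (1 - q ^+ r.*2.+1) * e (n - r) * e (n + r + 1)
  = \sum_(r < n.+1) (c r - delay (fun r => c r * q ^+ r.*2.+1) r)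
      * e (n - r) * e (n + r + 0).
Proof.
transitivity (\sum_(r < n.+1) c r * e (n - r) * e (n + r)
   - \sum_(r < n) c r * q ^+ r.*2.+1 * e (n - r.+1) * e (n + r.+1)).
  rewrite !big_ord_recr /= addrAC -sumrB; congr (_ + _).
    apply: eq_bigr => -[r /= rn] _; rewrite addn1 -(eS (n + r)) addnS.
    have [d nE] : exists d, n = (d + r.+1)%N.
      by exists (n - r.+1)%N; rewrite subnK.
    have -> : (n - r = d.+1)%N by rewrite nE; lia.
    have -> : (n - r.+1 = d)%N by rewrite nE; lia.
    have -> : ((n + r).+1 = d.+1 + r.*2.+1)%N by rewrite nE; lia.
    rewrite -(eS d) exprD; ring.
  by rewrite -addnn -(eS (n + n)) addn1; ring.
rewrite [X in _ = X]big_ord_recl /= subr0 addn0 big_ord_recl /= -addrA addn0.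
congr (_ + _).
rewrite -sumrB; apply: eq_bigr => r _; rewrite /bump add1n addn0; ring.
Qed.

(** The exponent is (5 r^2 + 3 r) / 2: the unit exponent r (r - 1) / 2 plus
r^2 + r for each of the two uses of Bailey's lemma. *)
Definition rr_alpha r : R := (-1) ^+ r * q ^+ ('C(r, 2) + (r * r + r).*2).

(** For r > 0 this is (-1)^r (q^((5r^2+3r)/2) + q^((5r^2-3r)/2)): the terms r
and -r of one series over the integers. *)
Definition rr_alpha_folded r : R :=
  rr_alpha r - delay (fun r => rr_alpha r * q ^+ r.*2.+1) r.

(** Applied to the unit pair, Bailey's lemma gives a pair with beta = e; applied
to that pair it gives the sum below. *)
Lemma andrews_gordon_inner n :
  \sum_(s < n.+1) q ^+ (s * s + s) * e (n - s) * e s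
  = \sum_(r < n.+1) rr_alpha_folded r * e (n - r) * e (n + r + 0).
Proof.
rewrite -change_of_parameter.
have step1 s : e s = \sum_(r < s.+1)
    (unit_alpha q r * q ^+ (r * r + 1 * r)) * e (s - r) * e (s + r + 1).
  rewrite -(bailey_lemma e0 eS (unit_bailey_pair e0 eS)).
  rewrite big_ord_recl big1 ?addr0 /= => [|i _]; last by rewrite mulr0.
  by rewrite subn0 muln0 expr0 mul1r mulr1.
pose alpha r := unit_alpha q r * q ^+ (r * r + 1 * r).
have := bailey_lemma (alpha := alpha) e0 eS step1 n.
under eq_bigr do rewrite mul1n; move=> ->; apply: eq_bigr => r _.
congr (_ * _ * _); rewrite /alpha /unit_alpha /rr_alpha mul1n -!addnn.
rewrite ?(exprS, exprD); ring.
Qed.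

(** The last use of Bailey's lemma, with a = 1, brings in the outer factor
q^(s^2). *)
Lemma andrews_gordon_finite n :
  \sum_(s < n.+1) q ^+ (s * s) * e (n - s) *
     (\sum_(t < s.+1) q ^+ (t * t + t) * e (s - t) * e t)
  = \sum_(r < n.+1) rr_alpha_folded r
       * q ^+ (r * r) * e (n - r) * e (n + r).
Proof.
have := bailey_lemma e0 eS andrews_gordon_inner n.
under eq_bigr do rewrite mul0n addn0.
by under [X in _ = X -> _]eq_bigr do rewrite mul0n !addn0.
Qed.
End Chain.

(** * Jacobi's triple product *)

Section Jacobi.
Local Open Scope ring_scope.
Variables (R : comNzRingType) (x y : R).
Let Q := x * y.

(** With j = k - m', the term (-1)^j x^(j(j+1)/2) y^(j(j-1)/2) of the theta
series.  Since j may be negative, each of the two exponents is a sum of two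
binomials in truncated differences, of which at least one vanishes. *)
Definition jacobi_term (m' k : nat) : R :=
  (-1) ^+ (m' + k) * x ^+ ('C(k.+1 - m', 2) + 'C(m' - k, 2))
                   * y ^+ ('C(k - m', 2) + 'C(m'.+1 - k, 2)).

Lemma jacobi_termSS m k : jacobi_term m.+1 k.+1 = jacobi_term m k.
Proof. by rewrite /jacobi_term !subSS !addSn addnS !exprS !mulN1r opprK. Qed.

Lemma jacobi_term_geq m j : jacobi_term m (m + j) =
  (-1) ^+ j * x ^+ 'C(j.+1, 2) * y ^+ 'C(j, 2).
Proof.
elim: m => [|m IHm]; last by rewrite addSn jacobi_termSS.
rewrite /jacobi_term !subn0 add0n sub0n addn0.
by case: j => [|[|j]]; rewrite /= ?addn0.
Qed.

Lemma jacobi_term_leq k i : jacobi_term (k + i) k =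
  (-1) ^+ i * x ^+ 'C(i, 2) * y ^+ 'C(i.+1, 2).
Proof.
elim: k => [|k IHk]; last by rewrite addSn jacobi_termSS.
rewrite /jacobi_term !subn0 add0n sub0n addn0; case: i => [|[|j]] //.
Qed.

Lemma jacobi_term_up m k M : (k <= M + m)%N ->
  jacobi_term m k.+1 * Q ^+ (M + m - k) = - (x * Q ^+ M) * jacobi_term m k.
Proof.
move=> kM; rewrite /Q; case: (leqP m k) => [mk|km].
  have [j jE] : exists j, k = (m + j)%N by exists (k - m)%N; lia.
  rewrite jE -addnS !jacobi_term_geq.
  have [d ->] : exists d, M = (d + j)%N by exists (M - j)%N; lia.
  have -> : (d + j + m - (m + j) = d)%N by lia.
  rewrite !exprMn !(binS _ 1) !bin1 ?(exprS, exprD); ring.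
have [i ->] : exists i, m = (k.+1 + i)%N by exists (m - k.+1)%N; lia.
rewrite jacobi_term_leq addSnnS jacobi_term_leq.
have -> : (M + (k + i.+1) - k = M + i.+1)%N by lia.
rewrite !exprMn !(binS _ 1) !bin1 ?(exprS, exprD); ring.
Qed.

Lemma jacobi_term_down m k :
  jacobi_term m.+1 k * Q ^+ k = - (y * Q ^+ m) * jacobi_term m k.
Proof.
rewrite /Q; case: (leqP m.+1 k) => [mk|km].
  have [j ->] : exists j, k = (m.+1 + j)%N by exists (k - m.+1)%N; lia.
  rewrite jacobi_term_geq addSnnS jacobi_term_geq.
  rewrite !exprMn !(binS _ 1) !bin1 ?(exprS, exprD); ring.
have [i ->] : exists i, m = (k + i)%N by exists (m - k)%N; lia.
rewrite -addnS !jacobi_term_leq.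
rewrite !exprMn !(binS _ 1) !bin1 ?(exprS, exprD); ring.
Qed.

(** A truncated triple product is the q-binomial theorem with its index
recentred at m'.  A new factor in x acts through one form of Pascal's rule and a
new factor in y through the other; [jacobi_term_up] and [jacobi_term_down]
absorb the powers of Q that these produce. *)
Lemma finite_jacobi m m' :
  (\prod_(i < m) (1 - x * Q ^+ i)) * (\prod_(i < m') (1 - y * Q ^+ i))
  = \sum_(k < (m + m').+1) jacobi_term m' k * qbin Q (m + m') k.
Proof.
elim: m => [|m IHm].
  rewrite big_ord0 mul1r add0n; elim: m' => [|m' IHm'].
    by rewrite big_ord0 big_ord1 qbin0 mulr1 (jacobi_term_leq 0 0) !expr0 !mulr1.
  rewrite big_ord_recr /= IHm'.
  pose F k := jacobi_term m' k * qbin Q m' k.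
  pose G k := jacobi_term m'.+1 k * Q ^+ k * qbin Q m' k.
  transitivity (\sum_(k < m'.+1) F k + \sum_(k < m'.+1) G k).
    rewrite mulrBr mulr1 mulr_suml -sumrB -big_split /=.
    by apply: eq_bigr => k _; rewrite /F /G jacobi_term_down; ring.
  have -> : \sum_(k < m'.+1) G k = \sum_(k < m'.+2) G k.
    by rewrite [RHS]big_ord_recr /= {3}/G qbin_small // mulr0 addr0.
  rewrite [X in _ + X]big_ord_recl [RHS]big_ord_recl addrCA -big_split /=.
  congr (_ + _); first by rewrite /G qbin0 expr0 !mulr1.
  by apply: eq_bigr => k _; rewrite /= /bump add1n /F /G jacobi_termSS qbinS; ring.
rewrite big_ord_recr /= mulrAC IHm addSn.
pose F k := jacobi_term m' k * qbin Q (m + m') k.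
pose G k := jacobi_term m' k.+1 * Q ^+ (m + m' - k) * qbin Q (m + m') k.
transitivity (\sum_(k < (m + m').+1) F k + \sum_(k < (m + m').+1) G k).
  rewrite mulrBr mulr1 mulr_suml -sumrB -big_split /=.
  apply: eq_bigr => k _; rewrite /F /G jacobi_term_up; last by rewrite -ltnS.
  ring.
have -> : \sum_(k < (m + m').+1) F k = \sum_(k < (m + m').+2) F k.
  by rewrite [RHS]big_ord_recr /= {3}/F qbin_small // mulr0 addr0.
rewrite [X in X + _ = _]big_ord_recl [RHS]big_ord_recl -addrA -big_split /=.
congr (_ + _); first by rewrite /F !qbin0.
apply: eq_bigr => k _; rewrite /= /bump add1n /F /G qbinSr; last by rewrite -ltnS.
ring.
Qed.

(** The symmetric case of [finite_jacobi], with the terms j and -j paired. *)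
Lemma folded_jacobi m :
  \prod_(i < m) ((1 - x * Q ^+ i) * (1 - y * Q ^+ i))
  = qbin Q (m + m) m + \sum_(j < m) (-1) ^+ j.+1 *
      (x ^+ 'C(j.+2, 2) * y ^+ 'C(j.+1, 2) * qbin Q (m + m) (m + j.+1)
       + x ^+ 'C(j.+1, 2) * y ^+ 'C(j.+2, 2) * qbin Q (m + m) (m - j.+1)).
Proof.
rewrite big_split /= finite_jacobi -[(m + m).+1]addnS big_split_ord /=.
rewrite big_ord_recl /= addn0.
have -> : jacobi_term m m = 1.
  by rewrite -{2}[m]addn0 jacobi_term_geq !expr0 !mul1r.
rewrite mul1r [X in X + _](reindex_inj rev_ord_inj) addrCA -big_split /=.
congr (_ + _).
apply: eq_bigr => j _; rewrite /bump add1n jacobi_term_geq.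
have -> : jacobi_term m (m - j.+1)
    = (-1) ^+ j.+1 * x ^+ 'C(j.+1, 2) * y ^+ 'C(j.+2, 2).
  by rewrite -{1}(subnK (ltn_ord j)) jacobi_term_leq.
ring.
Qed.
End Jacobi.

(** * The Andrews-Gordon identity modulo a power of q *)

Lemma bin2_double j : 'C(j, 2).*2 + j = j * j.
Proof. by elim: j => // j IHj; rewrite binS bin1; lia. Qed.

Definition allowed7 (i : nat) : bool := i %% 7 \notin [:: 0; 2; 5].

Section Nilpotent.
Local Open Scope ring_scope.
Variables (R : comNzRingType) (n : nat).

Definition geom (x : R) : R := \sum_(t < n.+1) x ^+ t.

Definition inv_qfact (q : R) m : R := \prod_(i < m) geom (q ^+ i.+1).

Lemma inv_qfact0 q : inv_qfact q 0 = 1.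
Proof. by rewrite /inv_qfact big_ord0. Qed.

Lemma geomK x : x ^+ n.+1 = 0 -> geom x * (1 - x) = 1.
Proof.
by move=> xn; rewrite /geom mulrC -opprB mulNr -subrX1 xn sub0r opprK.
Qed.

Lemma expr_gt_nil (q : R) k : q ^+ n.+1 = 0 -> (n < k)%N -> q ^+ k = 0.
Proof. by move=> qn nk; rewrite -(subnK nk) exprD qn mulr0. Qed.

Lemma geomXK q i : q ^+ n.+1 = 0 -> geom (q ^+ i.+1) * (1 - q ^+ i.+1) = 1.
Proof.
by move=> qn; rewrite geomK // -exprM (expr_gt_nil qn) // mulSn leq_addr.
Qed.

Lemma inv_qfactS q : q ^+ n.+1 = 0 ->
  forall m, inv_qfact q m.+1 * (1 - q ^+ m.+1) = inv_qfact q m.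
Proof.
by move=> qn m; rewrite /inv_qfact big_ord_recr /= -mulrA geomXK // mulr1.
Qed.

(** Beyond n the factors 1 - q^i are 1, so that inv_qfact q n is the inverse of
the infinite product. *)
Lemma inv_qfact_stable q m : q ^+ n.+1 = 0 -> (n <= m)%N ->
  inv_qfact q m = inv_qfact q n.
Proof.
move=> qn; elim: m => [|m IHm]; first by rewrite leqn0 => /eqP->.
rewrite leq_eqVlt => /predU1P[-> // | nm].
by rewrite -IHm // -(inv_qfactS qn m) (expr_gt_nil qn) // subr0 mulr1.
Qed.

Lemma qbin_stable q k l : q ^+ n.+1 = 0 -> (n <= k)%N -> (n <= l)%N ->
  qbin q (k + l) k = inv_qfact q n.
Proof.
move=> qn nk nl.
apply: (@mulr_e_inj _ q (inv_qfact q) (inv_qfact0 q) (inv_qfactS qn) n) => /=.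
have := qbin_quotient (inv_qfact0 q) (inv_qfactS qn) k l.
by rewrite !inv_qfact_stable // (leq_trans nk) // leq_addr.
Qed.

Variable (q : R).
Hypothesis qn : q ^+ n.+1 = 0.
Let e := inv_qfact q.
Let e0 : e 0 = 1 := inv_qfact0 q.
Let eS : forall m, e m.+1 * (1 - q ^+ m.+1) = e m := inv_qfactS qn.

(** The sum of (-1)^r q^((7r^2+3r)/2) over the integers, with r and -r taken
together; the terms with r > n vanish, and the bound n.*2 is the one that comes
out of the two finite identities. *)
Definition theta_mod7 : R :=
  \sum_(r < n.*2.+1) rr_alpha_folded q r * q ^+ (r * r).

(** [andrews_gordon_finite] at n.*2: only indices up to n contribute, so that all
arguments of e that grow with n are at least n, and one factor e n cancels. *)
Lemma andrews_gordon_theta :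
  \sum_(s < n.+1) q ^+ (s * s) *
     (\sum_(t < s.+1) q ^+ (t * t + t) * e (s - t) * e t)
  = e n * theta_mod7.
Proof.
apply: (@mulr_e_inj _ q e e0 eS n) => /=.
pose F s := \sum_(t < s.+1) q ^+ (t * t + t) * e (s - t) * e t.
transitivity (\sum_(s < n.*2.+1) q ^+ (s * s) * e (n.*2 - s) * F s).
  rewrite [RHS](bigID (fun s : 'I_ _ => (s < n.+1)%N)) /=.
  rewrite [X in _ = _ + X]big1 ?addr0.
    have nn : (n.+1 <= n.*2.+1)%N by lia.
    rewrite -(big_ord_widen _ (fun s => q ^+ (s * s) * e (n.*2 - s) * F s)) //.
    rewrite mulr_suml; apply: eq_bigr => s _.
    have -> : e (n.*2 - s) = e n.
      by apply: inv_qfact_stable => //; have := ltn_ord s; lia.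
    by rewrite mulrAC.
  by move=> s ns; rewrite (expr_gt_nil qn) ?mul0r //; nia.
rewrite (andrews_gordon_finite e0 eS) /theta_mod7 mulr_sumr mulr_suml.
apply: eq_bigr => r _; case: (leqP r n) => rn.
  have -> : e (n.*2 - r) = e n by apply: inv_qfact_stable => //; lia.
  have -> : e (n.*2 + r) = e n by apply: inv_qfact_stable => //; lia.
  ring.
have -> : q ^+ (r * r) = 0 by apply: (expr_gt_nil qn); nia.
by rewrite !(mulr0, mul0r).
Qed.

(* These choices make Q = q^7, and the term j of the triple product becomes
   (-1)^j q^(5 j (j + 1) / 2 + j (j - 1)) = (-1)^j q^((7 j^2 + 3 j) / 2). *)
Let x := q ^+ 5.
Let y := q ^+ 2.
Let Q := x * y.

Lemma Q_pow7 : Q = q ^+ 7. Proof. by rewrite /Q /x /y -exprD. Qed.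

Lemma Q_nil : Q ^+ n.+1 = 0.
Proof. by rewrite Q_pow7 -exprM (expr_gt_nil qn) //; lia. Qed.

Lemma jacobi_theta_mod7 :
  \prod_(i < n.*2) ((1 - x * Q ^+ i) * (1 - y * Q ^+ i))
  = inv_qfact Q n * theta_mod7.
Proof.
rewrite folded_jacobi -/Q qbin_stable ?Q_nil -?addnn ?leq_addr //.
rewrite /theta_mod7 -addnn big_ord_recl /= /rr_alpha_folded /= subr0 /rr_alpha.
rewrite !expr0 !mulr1 mulrDr mulr1.
congr (_ + _); rewrite mulr_sumr; apply: eq_bigr => j _.
rewrite /bump add1n /= /x /y -!exprM.
have bj := bin2_double j.
have large k : (n <= j)%N -> (j < k)%N -> q ^+ k = 0.
  by move=> nj jk; apply: (expr_gt_nil qn); lia.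
rewrite !(binS _ 1) !bin1 -!exprD.
rewrite ?add0n; set a := (5 * (_ + j.+1) + _)%N; set b := (5 * _ + _)%N.
transitivity ((-1) ^+ j.+1 * (q ^+ a + q ^+ b) * inv_qfact Q n).
  case: (leqP n j) => nj.
    by rewrite (large a nj) ?(large b nj) ?(mul0r, mulr0, addr0) // /a /b; lia.
  have -> : qbin Q (n + n + (n + n)) (n + n + j.+1) = inv_qfact Q n.
    have -> : (n + n + (n + n) = (n + n + j.+1) + (n + n - j.+1))%N by lia.
    by apply: qbin_stable; rewrite ?Q_nil //; lia.
  have -> : qbin Q (n + n + (n + n)) (n + n - j.+1) = inv_qfact Q n.
    have -> : (n + n + (n + n) = (n + n - j.+1) + (n + n + j.+1))%N by lia.
    by apply: qbin_stable; rewrite ?Q_nil //; lia.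
  ring.
have -> : a = ('C(j.+1, 2) + (j.+1 * j.+1 + j.+1).*2 + j.+1 * j.+1)%N.
  by rewrite /a binS bin1; lia.
have -> : b = ('C(j, 2) + (j * j + j).*2 + j.*2.+1 + j.+1 * j.+1)%N.
  by rewrite /b; lia.
rewrite binS bin1 exprS !exprD; ring.
Qed.

(** In each block of seven consecutive indices, the three factors that belong to
the residues 0, 2, 5 are cancelled by a factor of the triple product. *)
Lemma euler_product m :
  \prod_(i < 7 * m) (if allowed7 i.+1 then geom (q ^+ i.+1) else 1)
  = e (7 * m) * qpoch Q m * \prod_(i < m) ((1 - x * Q ^+ i) * (1 - y * Q ^+ i)).
Proof.
rewrite /e /inv_qfact /qpoch; elim: m => [|m IHm].
  by rewrite muln0 !big_ord0 !mulr1.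
rewrite mulnS addnC !addnS addn0 !big_ord_recr /= IHm /allowed7.
have -> : ((7 * m).+1 %% 7 = 1)%N by lia.
have -> : ((7 * m).+2 %% 7 = 2)%N by lia.
have -> : ((7 * m).+3 %% 7 = 3)%N by lia.
have -> : ((7 * m).+4 %% 7 = 4)%N by lia.
have -> : ((7 * m).+1.+4 %% 7 = 5)%N by lia.
have -> : ((7 * m).+2.+4 %% 7 = 6)%N by lia.
have -> : ((7 * m).+3.+4 %% 7 = 0)%N by lia.
rewrite !inE /=.
have -> : 1 - y * Q ^+ m = 1 - q ^+ (7 * m).+2 by rewrite Q_pow7 -exprM -exprD.
have -> : 1 - x * Q ^+ m = 1 - q ^+ (7 * m).+1.+4 by rewrite Q_pow7 -exprM -exprD.
have -> : 1 - Q ^+ m.+1 = 1 - q ^+ (7 * m).+3.+4.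
  by rewrite Q_pow7 -exprM mulnS.
have := geomXK (7 * m).+1 qn; have := geomXK (7 * m).+4 qn.
have := geomXK (7 * m).+2.+4 qn.
set g7 := geom _; set d7 := 1 - _ => h7; set g5 := geom _; set d5 := 1 - _ => h5.
set g2 := geom _; set d2 := 1 - _ => h2.
set P := \prod_(i < 7 * m) _; set W := \prod_(i < m) _.
set V := \prod_(i < m) _; set g1 := geom _; set g3 := geom _; set g4 := geom _.
set g6 := geom _.
transitivity (P * W * V * g1 * g3 * g4 * g6 * (g2 * d2) * (g5 * d5) * (g7 * d7)).
  rewrite h2 h5 h7; ring.
ring.
Qed.

Lemma andrews_gordon_product :
  \sum_(s < n.+1) q ^+ (s * s) *
     (\sum_(t < s.+1) q ^+ (t * t + t) * e (s - t) * e t)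
  = \prod_(i < 7 * n.*2) (if allowed7 i.+1 then geom (q ^+ i.+1) else 1).
Proof.
rewrite andrews_gordon_theta euler_product jacobi_theta_mod7.
have -> : e (7 * n.*2) = e n by apply: inv_qfact_stable => //; lia.
rewrite -[RHS]mulrA; congr (_ * _).
have -> : qpoch Q n.*2 * (inv_qfact Q n * theta_mod7)
    = (qpoch Q n.*2 * inv_qfact Q n.*2) * theta_mod7.
  by rewrite (@inv_qfact_stable Q n.*2) ?Q_nil ?mulrA // -addnn leq_addr.
by rewrite (qpochK (inv_qfact0 Q) (inv_qfactS Q_nil)) mul1r.
Qed.
End Nilpotent.

(** * Weights as numbers of markings *)

Lemma fibSS n : fib n.+2 = fib n.+1 + fib n. Proof. by []. Qed.
Lemma fib0 : fib 0 = 0. Proof. by []. Qed.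
Lemma fib1 : fib 1 = 1. Proof. by []. Qed.
Arguments fib : simpl never.
Definition fibE := (fibSS, fib1, fib0).

Definition gap2 (x y : nat) : bool := y.+2 <= x.

Lemma gap2_trans : transitive gap2.
Proof. by rewrite /gap2 => y x z; lia. Qed.

Lemma inRE p : inR p = sorted gap2 p.
Proof.
rewrite (sorted_pairwise gap2_trans) /inR; apply: eq_pairwise => x y /=.
by rewrite /gap2; apply/idP/idP; lia.
Qed.

(** The numbers of markings of p in which the run of its largest part is
unmarked and marked.  A gap 2 continues the top run, a gap 3 forbids two marked
neighbours, and a larger gap is free; the last match is the constraint on a run
that ends in 1 or in 2.  The empty partition has one marking. *)
Fixpoint markings (p : seq nat) : nat * nat :=
  if p is x :: s then
    let: (a, b) := markings s in
    if s is y :: _ then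
      match x - y with 2 => (a, b) | 3 => (a + b, a) | _ => (a + b, a + b) end
    else match x with 1 => (0, 1) | 2 => (1, 0) | _ => (1, 1) end
  else (1, 0).

Lemma markings_cons x y s : markings (x :: y :: s) =
  let: (a, b) := markings (y :: s) in
  match x - y with 2 => (a, b) | 3 => (a + b, a) | _ => (a + b, a + b) end.
Proof. by []. Qed.

Definition nmarkings p := (markings p).1 + (markings p).2.

(** The pair for the lowest run of a string that ends in l and stands above
rest. *)
Definition bottom_markings (rest : seq nat) (l : nat) : nat * nat :=
  if rest is [::] then match l with 1 => (0, 1) | 2 => (1, 0) | _ => (1, 1) end
  else (nmarkings rest, nmarkings rest).

Lemma chain3_cons x y s : chain3 (x :: y :: s) = (x - y <= 3) && chain3 (y :: s).
Proof. by []. Qed.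

Lemma eta3_cons x y s : eta3 (x :: y :: s) = (x - y == 3) + eta3 (y :: s).
Proof. by []. Qed.

Definition separated (x : nat) (rest : seq nat) : bool :=
  if rest is y :: _ then 4 <= x - y else true.

(** Along a string the pair is multiplied by the Fibonacci matrix
(1 1; 1 0) once for every gap 3.  The match stands for the entry F_(k-1), with
F_(-1) = 1. *)
Lemma markings_string x psi rest :
  sorted gap2 (x :: psi ++ rest) -> chain3 (x :: psi) ->
  separated (last x psi) rest ->
  let: (a, b) := bottom_markings rest (last x psi) in
  let k := eta3 (x :: psi) in
  markings (x :: psi ++ rest) = (fib k.+1 * a + fib k * b,
     if k is k'.+1 then fib k * a + fib k' * b else b).
Proof.
elim: psi x => [|y psi IH] x.
  case: rest => [|z rest].
    by case: x => [|[|[|x]]].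
  rewrite [cat _ _]/= /separated [last _ _]/= => _ _ gap.
  have -> : markings [:: x, z & rest]
      = (nmarkings (z :: rest), nmarkings (z :: rest)).
    rewrite markings_cons /nmarkings; case: (markings (z :: rest)) => a b.
    by case: (x - z) gap => [|[|[|[|d]]]].
  by rewrite /bottom_markings /eta3 /= mul0n mul1n addn0.
rewrite cat_cons chain3_cons => /andP[xy s] /andP[le3 c3] gap.
have := IH y s c3 gap; rewrite [last x _]/= eta3_cons.
case: (bottom_markings _ _) => a b; set k := eta3 _ => E; rewrite markings_cons.
have : (x - y == 2) || (x - y == 3) by move: xy le3; rewrite /gap2; lia.
rewrite -cat_cons E; case/orP=> /eqP->.
  by [].
rewrite eqxx add1n; congr (_, _).
case: k {E} => [|k]; rewrite /= ?fibE; lia.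
Qed.

Lemma gap2_rcons s l : sorted gap2 (rcons s l) -> all (leq l.+2) s.
Proof.
rewrite (sorted_pairwise gap2_trans) -cats1 pairwise_cat allrel1r.
by case/and3P.
Qed.

Lemma chain3_cat s m l t : chain3 (rcons s m ++ l :: t) -> m - l <= 3.
Proof.
elim: s => [|x [|y s] IH]; first by rewrite /= chain3_cons; case/andP.
  by rewrite /= chain3_cons => /andP[_]; apply: IH.
rewrite !rcons_cons !cat_cons chain3_cons -cat_cons -rcons_cons.
by case/andP=> _; apply: IH.
Qed.

(** By [markings_string] the string contributes F_(k+2) a + F_(k+1) b, and the
bottom pairs (1, 1), (1, 0) and (0, 1) give the three weights.  A string that
contains 1 has weight F_(k+1) in every case, because the exceptional string [1]
has k = 0 and F_2 = F_1. *)
Lemma nmarkings_string x psi rest :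
  sorted gap2 (x :: psi ++ rest) -> all (leq 1) (x :: psi ++ rest) ->
  chain3 (x :: psi) ->
  separated (last x psi) rest ->
  nmarkings (x :: psi ++ rest) = string_weight6 (x :: psi) * nmarkings rest.
Proof.
move=> sp pos c3 gap; have := markings_string sp c3 gap.
have below : all (leq (last x psi)) (x :: psi).
  move: sp; rewrite -cat_cons => /(subseq_sorted gap2_trans (prefix_subseq _ _)).
  rewrite lastI => /gap2_rcons below.
  by rewrite all_rcons leqnn; apply: sub_all below => i; lia.
case E : (bottom_markings _ _) => [a b] L.
rewrite {1}/nmarkings L /string_weight6.
set k := eta3 _ in L *.
case: rest gap sp pos E L => [|y rest] gap sp pos;
  rewrite /bottom_markings; last first.
  move=> [<- <-] L; rewrite /separated in gap.
  have -> : all (leq 3) (x :: psi).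
    by apply: sub_all below => i; apply: leq_trans; lia.
  by rewrite addn3; case: k {L} => [|k]; rewrite /= ?fibE; lia.
rewrite cats0 muln1 in sp pos *.
have llast : last x psi \in x :: psi by rewrite mem_last.
case E1 : (last x psi) llast below => [|[|[|l]]] llast below E L.
- by have := allP pos _ llast.
- case: E => <- <-; have -> : all (leq 3) (x :: psi) = false.
    by apply/allPn; exists 1.
  have two : 2 \notin x :: psi.
    rewrite lastI E1 mem_rcons inE /=; apply/negP => /(allP (gap2_rcons _)).
    by move=> /(_ 1); rewrite -E1 -lastI => /(_ sp); rewrite E1.
  rewrite (negPf two) orbF llast andTb /k.
  case: psi {gap below L k pos two} sp c3 E1 llast => [|y psi] sp c3 E1 llast.
    by move: E1 => /= ->.
  have : (3 \in x :: y :: psi) || (4 \in x :: y :: psi).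
    move: sp c3; rewrite lastI E1.
    case/lastP: (belast _ _) (size_belast x (y :: psi)) => // s m _.
    move=> /gap2_rcons; rewrite all_rcons => /andP[m3 _] m34.
    have m4 : m - 1 <= 3.
      by move: m34; rewrite -[rcons (rcons _ _) _]cats1 => /chain3_cat.
    rewrite !mem_rcons !inE !mem_rcons !inE; lia.
  rewrite -negb_or => ->; rewrite addn1.
  by case: (eta3 _) => [|k'] /=; rewrite ?fibE; lia.
- case: E => <- <-; have -> : all (leq 3) (x :: psi) = false.
    by apply/allPn; exists 2.
  by rewrite llast orbT addn2; case: (k) => [|k'] /=; rewrite ?fibE; lia.
- case: E => <- <-; have -> : all (leq 3) (x :: psi).
    by apply: sub_all below => i; apply: leq_trans; lia.
  by rewrite addn3; case: (k) => [|k'] /=; rewrite ?fibE; lia.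
Qed.

Lemma cat_eq_cat (T : Type) (a b c d : seq T) : a ++ b = c ++ d ->
  (exists t, c = a ++ t /\ b = t ++ d) \/ (exists t, a = c ++ t /\ d = t ++ b).
Proof.
elim: a c => [|x a IH] [|y c] /=.
- by move=> ->; left; exists [::].
- by move=> ->; left; exists (y :: c).
- by move=> <-; right; exists (x :: a).
- case=> -> /IH[[t [-> ->]]|[t [-> ->]]]; first by left; exists t.
  by right; exists t.
Qed.

(** Differences at most 3 cannot straddle a gap of at least 4. *)
Lemma infix_separated x psi rest phi : separated (last x psi) rest ->
  chain3 phi -> infix phi (x :: psi ++ rest) ->
  infix phi (x :: psi) \/ infix phi rest.
Proof.
move=> sep c3 /infixP[s1 [s2]]; rewrite -cat_cons => /esym/cat_eq_cat.
case=> [[t [psiE]]|[t [_ ->]]]; last first.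
  by right; apply/infixP; exists t, s2.
case/cat_eq_cat=> [[t' [tE _]]|[v [phiE restE]]].
  by left; apply/infixP; exists s1, t'; rewrite psiE tE.
case: v => [|y v] in phiE restE.
  by left; rewrite phiE cats0 psiE suffix_infix ?suffix_suffix.
case/lastP: t => [|t m] in psiE phiE.
  by right; rewrite phiE restE prefix_infix // prefix_prefix.
have lm : last x psi = m.
  by rewrite -[last x psi]/(last x (x :: psi)) psiE last_cat last_rcons.
move: sep; rewrite restE lm /= => sep.
by move: c3; rewrite phiE => /chain3_cat; lia.
Qed.

Lemma blocks_uniq p : uniq p -> uniq (blocks p).
Proof.
move=> up; apply: allpairs_uniq_dep => [|i _|]; rewrite ?iota_uniq //.
move=> _ _ /allpairsPdep[i [k [ip kp ->]]] /allpairsPdep[j [l [jp lp ->]]] /= E.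
move: ip kp jp lp; rewrite !mem_iota => ip kp jp lp.
have ij : i = j.
  have := congr1 (nth 0 ^~ 0) E; rewrite !nth_take ?nth_drop ?addn0; try lia.
  by move/eqP; rewrite nth_uniq //; try lia; move/eqP.
subst j; congr existT; have := congr1 size E.
by rewrite !size_take_min !size_drop; lia.
Qed.

(** The strings of a partition are its top string and the strings of the parts
below: by [infix_separated], maximality can be tested on either side of the
gap. *)
Lemma weight6_string x psi rest :
  uniq (x :: psi ++ rest) -> chain3 (x :: psi) -> separated (last x psi) rest ->
  weight6 (x :: psi ++ rest) = string_weight6 (x :: psi) * weight6 rest.
Proof.
move=> up c3 sep; rewrite /weight6.
have disj phi : phi <> [::] -> infix phi (x :: psi) -> infix phi rest -> False.
  case: phi => [|y phi] // _ /mem_infix/(_ y (mem_head _ _)) yp.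
  move=> /mem_infix/(_ y (mem_head _ _)) yr.
  move: up; rewrite -cat_cons cat_uniq => /and3P[_ /hasPn/(_ y yr)].
  by rewrite /= yp.
have psi_in : infix (x :: psi) (x :: psi ++ rest).
  by rewrite -cat_cons prefix_infix // prefix_prefix.
have rest_in : infix rest (x :: psi ++ rest).
  by rewrite -cat_cons suffix_infix // suffix_suffix.
rewrite (perm_big ((x :: psi) :: strings rest)) ?big_cons //=.
apply: uniq_perm.
- exact/filter_uniq/blocks_uniq.
- rewrite cons_uniq; apply/andP; split; last first.
    apply/filter_uniq/blocks_uniq.
    by move: up; rewrite -cat_cons cat_uniq => /and3P[].
  apply/negP => /stringsP[_ ir _ _].
  apply: (disj (x :: psi)) => //.
  exact: infix_refl.
move=> phi; rewrite inE; apply/stringsP/predU1P.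
  case=> n0 ip cp pmax; case: (infix_separated sep cp ip) => ip'.
    by left; rewrite (pmax (x :: psi)).
  right; apply/stringsP; split=> // chi ichi; apply: pmax.
  exact: infix_trans ichi rest_in.
case=> [->|/stringsP[n0 ir cp pmax]].
  split=> // chi ichi cchi pc; case: (infix_separated sep cchi ichi) => ic.
    apply/eqP; rewrite -(size_subseq_leqif (infixW ic)).
    by rewrite eqn_leq !size_subseq ?infixW.
  case: (disj (x :: psi)) => //; first exact: infix_refl.
  exact: infix_trans pc ic.
split=> // [|chi ichi cchi pc]; first exact: infix_trans ir rest_in.
case: (infix_separated sep cchi ichi) => ic; last exact: pmax.
by case: (disj phi) => //; apply: infix_trans pc ic.
Qed.

Lemma string_split x s : exists psi rest,
  [/\ s = psi ++ rest, chain3 (x :: psi) & separated (last x psi) rest].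
Proof.
elim: s x => [|y s IH] x; first by exists [::], [::].
case: (leqP 4 (x - y)) => [far|near]; first by exists [::], (y :: s).
have [psi [rest [-> c3 sep]]] := IH y.
by exists (y :: psi), rest; rewrite chain3_cons -ltnS near c3.
Qed.

Lemma gap2_uniq p : sorted gap2 p -> uniq p.
Proof. by apply: (sorted_uniq gap2_trans) => x; rewrite /gap2; lia. Qed.

Lemma weight6_nmarkings p : sorted gap2 p -> all (leq 1) p ->
  weight6 p = nmarkings p.
Proof.
elim: {p}(size p) {-2}p (leqnn (size p)) => [|n IH] [|x s] //=.
- by rewrite /weight6 big_nil.
- by rewrite /weight6 big_nil.
rewrite ltnS => ssz sp; have [psi [rest [sE c3 sep]]] := string_split x s.
rewrite sE in ssz sp * => pos.
rewrite weight6_string ?(nmarkings_string) //; last exact: (@gap2_uniq (x :: _)).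
congr (_ * _); apply: IH.
- by move: ssz; rewrite size_cat; lia.
- move: sp; rewrite -[path _ _ _]/(sorted gap2 ((x :: psi) ++ rest)).
  exact/subseq_sorted/suffix_subseq/gap2_trans.
by move: pos; rewrite all_cat => /and3P[].
Qed.

(** * Counting markings after removing the staircase *)

(** Lists are nonincreasing: an entry with m entries after it is raised by
2m + 1. *)
Fixpoint stair (s : seq nat) : seq nat :=
  if s is x :: s' then (x + (size s').*2.+1) :: stair s' else [::].

Fixpoint unstair (p : seq nat) : seq nat :=
  if p is x :: p' then (x - (size p').*2.+1) :: unstair p' else [::].

Lemma size_stair s : size (stair s) = size s.
Proof. by elim: s => //= x s ->. Qed.

Lemma size_unstair s : size (unstair s) = size s.
Proof. by elim: s => //= x s ->. Qed.

Lemma stairK : cancel stair unstair.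
Proof. by elim=> //= x s ->; rewrite size_stair addnK. Qed.

Lemma sumn_stair s : sumn (stair s) = size s * size s + sumn s.
Proof. by elim: s => //= x s ->; lia. Qed.

Lemma stair_pos s : all (leq 1) (stair s).
Proof. by elim: s => //= x s ->; rewrite addnS. Qed.

Lemma stair_sorted s : sorted gap2 (stair s) = sorted geq s.
Proof.
case: s => // x s; elim: s x => //= y s IH x; rewrite -IH /gap2; congr (_ && _).
by apply/idP/idP; lia.
Qed.

Lemma gap2_head x p : sorted gap2 (x :: p) -> all (leq 1) (x :: p) ->
  (size p).*2 < x.
Proof.
elim: p x => [|y p IH] x /=; first by move=> _ /andP[].
move=> /andP[xy yp] /andP[x0 pos]; have := IH _ yp pos.
by move: xy; rewrite /gap2; lia.
Qed.

Lemma unstairK p : sorted gap2 p -> all (leq 1) p -> stair (unstair p) = p.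
Proof.
elim: p => // x p IH sp pos; have h := gap2_head sp pos.
rewrite /= size_unstair subnK // IH //; first exact: path_sorted sp.
by case/andP: pos.
Qed.

Fixpoint bounded_lists (N V : nat) : seq (seq nat) :=
  if N is N'.+1 then [seq x :: s | x <- iota 0 V.+1, s <- bounded_lists N' x]
  else [:: [::]].

Lemma mem_bounded_lists N V s :
  (s \in bounded_lists N V) = (size s == N) && path geq V s.
Proof.
elim: N V s => [|N IH] V s; first by case: s => [|x s]; rewrite ?inE.
apply/allpairsPdep/idP => [[x [t [xV tN ->]]]|].
  move: xV tN; rewrite mem_iota IH /= => xV /andP[/eqP<- ->].
  by rewrite eqxx andbT /geq /=; lia.
case: s => // x s /andP[sN]; rewrite [path _ _ _]/= => /andP[xV xs].
exists x, s.
by rewrite mem_iota IH -eqSS sN xs; split=> //; rewrite /geq /= in xV; lia.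
Qed.

Lemma bounded_lists_uniq N V : uniq (bounded_lists N V).
Proof.
elim: N V => // N IH V.
apply: allpairs_uniq_dep => [|x _|]; rewrite ?iota_uniq //.
by move=> [x s] [y t] _ _ /= [-> ->].
Qed.

Lemma bounded_lists_split N V : bounded_lists N.+1 V.+1 =
  bounded_lists N.+1 V ++ [seq V.+1 :: s | s <- bounded_lists N V.+1].
Proof.
have iotaSr : iota 0 V.+2 = iota 0 V.+1 ++ [:: V.+1].
  by rewrite -[V.+2]addn1 iotaD.
transitivity [seq x :: s | x <- iota 0 V.+2, s <- bounded_lists N x] => //.
by rewrite iotaSr map_cat flatten_cat /= cats0.
Qed.

Lemma bounded_lists_V0 N :
  bounded_lists N.+1 0 = [seq 0 :: s | s <- bounded_lists N 0].
Proof. by rewrite /= cats0. Qed.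

Arguments bounded_lists : simpl never.

Lemma markings_stair x y s : (y <= x) -> markings (stair [:: x, y & s]) =
  let: (a, b) := markings (stair (y :: s)) in
  match x - y with 0 => (a, b) | 1 => (a + b, a) | _ => (a + b, a + b) end.
Proof.
move=> yx; rewrite [stair _]/= markings_cons -/(stair (y :: s)).
have -> : (x + (size s).+1.*2.+1 - (y + (size s).*2.+1) = (x - y).+2) by lia.
by case: (markings _) => a b; case: (x - y) => [|[|d]].
Qed.

Lemma markings_stair1 x : markings (stair [:: x]) =
  match x with 0 => (0, 1) | 1 => (1, 0) | _ => (1, 1) end.
Proof. by rewrite /= addn1; case: x => [|[|x]]. Qed.

Arguments stair : simpl never.
Arguments markings : simpl never.

Section Count.
Local Open Scope ring_scope.
Variables (R : comNzRingType) (q : R).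

Lemma big_bounded_lists N V (F : seq nat -> R) :
  \sum_(s <- bounded_lists N.+1 V.+1) F s =
  \sum_(s <- bounded_lists N.+1 V) F s
  + \sum_(s <- bounded_lists N V.+1) F (V.+1 :: s).
Proof. by rewrite bounded_lists_split big_cat big_map. Qed.

Definition markings_gf N V : R :=
  \sum_(s <- bounded_lists N V) (nmarkings (stair s))%:R * q ^+ sumn s.
(** The lists of N + 1 values with largest value V, according to whether the run
of V is marked. *)
Definition unmarked_top_gf N V : R :=
  \sum_(s <- bounded_lists N V)
    (markings (stair (V :: s))).1%:R * q ^+ (V + sumn s).
Definition marked_top_gf N V : R :=
  \sum_(s <- bounded_lists N V)
    (markings (stair (V :: s))).2%:R * q ^+ (V + sumn s).

Lemma markings_gfS N V :
  markings_gf N.+1 V.+1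
  = markings_gf N.+1 V + (unmarked_top_gf N V.+1 + marked_top_gf N V.+1).
Proof.
rewrite /markings_gf big_bounded_lists -big_split /=.
congr (_ + _); apply: eq_bigr => s _.
by rewrite -mulrDl -natrD.
Qed.

Lemma markings_gf0 V : markings_gf 0 V = 1.
Proof. by rewrite /markings_gf big_seq1 mul1r. Qed.

Lemma markings_gf_V0 N :
  markings_gf N.+1 0 = unmarked_top_gf N 0 + marked_top_gf N 0.
Proof.
rewrite /markings_gf bounded_lists_V0 big_map -big_split /=.
by apply: eq_bigr => s _; rewrite -mulrDl -natrD.
Qed.

Lemma unmarked_top_gf0 V : unmarked_top_gf 0 V = if V is 0 then 0 else q ^+ V.
Proof.
rewrite /unmarked_top_gf big_seq1 markings_stair1 addn0.
by case: V => [|[|V]] /=; rewrite ?mul0r ?mul1r.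
Qed.

Lemma marked_top_gf0 V : marked_top_gf 0 V = if V is 1 then 0 else q ^+ V.
Proof.
rewrite /marked_top_gf big_seq1 markings_stair1 addn0.
by case: V => [|[|V]] /=; rewrite ?mul0r ?mul1r.
Qed.

(** Remove the largest value V + 2.  The next value is at most V, or V + 1, or
V + 2: after adding the staircase these are a gap of at least 4, a gap 3, and a
gap 2 within the top run.  The projection pr keeps the unmarked and the marked
count in one statement. *)
Lemma top_step (pr : nat * nat -> nat) (V N : nat) :
  \sum_(s <- bounded_lists N.+1 V.+2)
    (pr (markings (stair (V.+2 :: s))))%:R * q ^+ (V.+2 + sumn s)
  = q ^+ V.+2 *
   (\sum_(s <- bounded_lists N.+1 V)
      (pr (nmarkings (stair s), nmarkings (stair s)))%:R * q ^+ sumn s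
   + \sum_(s <- bounded_lists N V.+1)
      (pr (nmarkings (stair (V.+1 :: s)), (markings (stair (V.+1 :: s))).1))%:R
        * q ^+ (V.+1 + sumn s)
   + \sum_(s <- bounded_lists N V.+2)
      (pr (markings (stair (V.+2 :: s))))%:R * q ^+ (V.+2 + sumn s)).
Proof.
rewrite 2!big_bounded_lists !mulrDr.
congr (_ + _ + _); rewrite mulr_sumr.
- apply: (eq_big_seq _) => s; rewrite mem_bounded_lists; case: s => // y s /=.
  rewrite /geq => /andP[_ /andP[/= yV _]].
  rewrite exprD mulrCA markings_stair; last by lia.
  rewrite /nmarkings; case: (markings _) => a b.
  by case E : (V.+2 - y)%N => [|[|d]] //; lia.
- apply: eq_bigr => s _; rewrite exprD mulrCA markings_stair //.
  by rewrite subSn // subnn /nmarkings; case: (markings _) => a b.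
apply: eq_bigr => s _; rewrite exprD mulrCA markings_stair //.
by rewrite subnn; case: (markings _).
Qed.

Lemma unmarked_top_gfS N V : unmarked_top_gf N.+1 V.+2 =
  q ^+ V.+2 * (markings_gf N.+1 V
               + (unmarked_top_gf N V.+1 + marked_top_gf N V.+1)
               + unmarked_top_gf N V.+2).
Proof.
rewrite /unmarked_top_gf (top_step fst); congr (_ * (_ + _ + _)).
by rewrite -big_split; apply: eq_bigr => s _ /=; rewrite -mulrDl -natrD.
Qed.

Lemma marked_top_gfS N V : marked_top_gf N.+1 V.+2 =
  q ^+ V.+2 * (markings_gf N.+1 V + unmarked_top_gf N V.+1 + marked_top_gf N V.+2).
Proof. by rewrite /marked_top_gf (top_step snd). Qed.

Lemma top_gf_V0 N : unmarked_top_gf N 0 = 0 /\ marked_top_gf N 0 = 1.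
Proof.
elim: N => [|N [IH0 IH1]]; first by rewrite unmarked_top_gf0 marked_top_gf0.
rewrite -IH0 -IH1 /unmarked_top_gf /marked_top_gf bounded_lists_V0 !big_map; split.
  by apply: eq_bigr => s _; rewrite markings_stair // subnn; case: (markings _).
by apply: eq_bigr => s _; rewrite markings_stair // subnn; case: (markings _).
Qed.

Lemma markings_gf_bound0 N : markings_gf N 0 = 1.
Proof.
case: N => [|N]; first exact: markings_gf0.
by rewrite markings_gf_V0; case: (top_gf_V0 N) => -> ->; rewrite add0r.
Qed.

Lemma marked_top_gf_V1 N : marked_top_gf N 1 = 0.
Proof.
elim: N => [|N IH]; first by rewrite marked_top_gf0.
rewrite /marked_top_gf big_bounded_lists bounded_lists_V0 big_map -[RHS]addr0.
congr (_ + _).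
  have [C0 _] := top_gf_V0 N.
  transitivity (q * unmarked_top_gf N 0); last by rewrite C0 mulr0.
  rewrite /unmarked_top_gf mulr_sumr.
  apply: eq_bigr => s _; rewrite markings_stair //; case: (markings _) => a b /=.
  by rewrite add0n exprS mulrCA.
transitivity (q * marked_top_gf N 1); last by rewrite IH mulr0.
rewrite /marked_top_gf mulr_sumr; apply: eq_bigr => s _.
by rewrite markings_stair // subnn; case: (markings _) => a b /=; rewrite exprS mulrCA.
Qed.

Lemma unmarked_top_gf_step N V :
  unmarked_top_gf N.+1 V.+1
  = q ^+ V.+1 * (markings_gf N.+1 V + unmarked_top_gf N V.+1).
Proof.
case: V => [|V]; last by rewrite markings_gfS unmarked_top_gfS.
rewrite markings_gf_V0 /unmarked_top_gf big_bounded_lists bounded_lists_V0.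
rewrite big_map mulrDr -big_split /=.
rewrite !mulr_sumr; congr (_ + _); apply: eq_bigr => s _.
  rewrite markings_stair // -mulrDl -natrD; case: (markings _) => a b /=.
  by rewrite !add0n exprD mulrCA.
by rewrite markings_stair // subnn; case: (markings _) => a b /=; rewrite exprD mulrCA.
Qed.

(** The sets of k values between 2 and V without two consecutive ones: the least
one is 2, 4, ..., 2k, and the excess over it is a partition into at most k
parts, each at most V - 2k.  For V < k the truncated difference still gives 0. *)
Definition sparse_gf k V : R := q ^+ (k * k + k) * qbin q (V - k) k.
(** The multisets of k values between 0 and V. *)
Definition multiset_gf k V : R := qbin q (k + V) k.

Lemma sparse_gf0 V : sparse_gf 0 V = 1.
Proof. by rewrite /sparse_gf qbin0 mul1r. Qed.

Lemma sparse_gfS k V :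
  sparse_gf k.+1 V.+2 = sparse_gf k.+1 V.+1 + q ^+ V.+2 * sparse_gf k V.
Proof.
rewrite /sparse_gf !subSS; case: (leqP k V) => kV; last first.
  rewrite !qbin_small ?(mulr0, addr0) //; lia.
rewrite subSn //.
case: (leqP k (V - k)) => kVk; last by rewrite !qbin_small ?(mulr0, addr0) //; lia.
rewrite qbinSr // mulrDr; congr (_ + _); rewrite !mulrA -!exprD.
congr (q ^+ _ * _); lia.
Qed.

Lemma multiset_gf0 V : multiset_gf 0 V = 1.
Proof. exact: qbin0. Qed.

Lemma multiset_gfS k V :
  multiset_gf k.+1 V.+1 = multiset_gf k.+1 V + q ^+ V.+1 * multiset_gf k V.+1.
Proof. by rewrite /multiset_gf addSn qbinSr ?leq_addr // addSnnS addKn. Qed.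

(** The pairs of such a set, with values at most U, and such a multiset, with
values at most V, that have N elements altogether. *)
Definition mixed_gf N U V : R :=
  \sum_(k < N.+1) sparse_gf k U * multiset_gf (N - k) V.

Lemma mixed_gf0 U V : mixed_gf 0 U V = 1.
Proof. by rewrite /mixed_gf big_ord1 sparse_gf0 multiset_gf0 mulr1. Qed.

Lemma mixed_gf_small N U V : (U <= 1)%N -> mixed_gf N U V = multiset_gf N V.
Proof.
move=> U1; rewrite /mixed_gf big_ord_recl sparse_gf0 mul1r subn0 big1 ?addr0 //.
by move=> k _; rewrite /sparse_gf qbin_small ?mulr0 ?mul0r //= /bump; lia.
Qed.

Lemma mixed_gf_multiset N U V :
  mixed_gf N.+1 U V.+1 = mixed_gf N.+1 U V + q ^+ V.+1 * mixed_gf N U V.+1.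
Proof.
rewrite /mixed_gf !(big_ord_recr N.+1) /= subnn !multiset_gf0 addrAC.
congr (_ + _); rewrite mulr_sumr -big_split; apply: eq_bigr => k _ /=.
have kN : (k <= N)%N by rewrite -ltnS.
by rewrite (subSn kN) multiset_gfS mulrDr (mulrCA (q ^+ _)).
Qed.

Lemma mixed_gf_sparse N U V :
  mixed_gf N.+1 U.+2 V = mixed_gf N.+1 U.+1 V + q ^+ U.+2 * mixed_gf N U V.
Proof.
rewrite /mixed_gf !(big_ord_recl N.+1) !sparse_gf0 -addrA; congr (_ + _).
rewrite mulr_sumr -big_split; apply: eq_bigr => k _ /=.
by rewrite /bump add1n subSS sparse_gfS mulrDl mulrA.
Qed.

(** A marked list corresponds to the pair of the set K of its marked values that
are at least 2 and of the multiset that is left when one copy of each element of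
K is removed.  If the top value V + 1 is unmarked, the multiset contains it and
K lies below it; if the top value V + 2 is marked, it belongs to K, whose other
elements are then at most V.  Both sides obey the same recurrences. *)
Lemma markings_gfE N :
  [/\ forall V, markings_gf N V = mixed_gf N V V,
      forall V, unmarked_top_gf N V.+1 = q ^+ V.+1 * mixed_gf N V V.+1
    & forall V, marked_top_gf N V.+2 = q ^+ V.+2 * mixed_gf N V V.+2].
Proof.
elim: N => [|N [_ IH0 IH1]].
  by split=> V; rewrite ?markings_gf0 ?unmarked_top_gf0 ?marked_top_gf0
    mixed_gf0 ?mulr1.
have G V : markings_gf N.+1 V = mixed_gf N.+1 V V.
  elim: V => [|V IHV].
    by rewrite markings_gf_bound0 mixed_gf_small // /multiset_gf addn0 qbinn.
  rewrite markings_gfS IHV IH0; case: V IHV => [|V] IHV.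
    rewrite marked_top_gf_V1 addr0.
    rewrite (@mixed_gf_small _ 1) // -(@mixed_gf_small _ 0) //.
    by rewrite mixed_gf_multiset.
  by rewrite IH1 mixed_gf_sparse (mixed_gf_multiset _ V.+1 V.+1) addrA.
split=> // V; first by rewrite unmarked_top_gf_step G IH0 mixed_gf_multiset.
by rewrite marked_top_gfS G IH0 IH1 !mixed_gf_multiset.
Qed.
End Count.

(** * From generating functions to partitions *)

(** Sums over partitions of n can be computed on any list that contains the
right sequences of sum n, whatever else it contains. *)
Lemma sum_intpart (T : nmodType) n (a : pred (seq nat)) (l : seq (seq nat))
    (F : seq nat -> T) :
  uniq l -> (forall s, sumn s = n -> (s \in l) = is_intpart n s && a s) ->
  (\sum_(p : intpart n | a p) F p = \sum_(s <- l | sumn s == n) F s)%R.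
Proof.
move=> ul lP; rewrite -[RHS]big_filter.
transitivity (\sum_(s <- [seq parts p | p <- enum {: intpart n}] | a s) F s)%R.
  by rewrite big_map big_enum_cond.
rewrite -[LHS]big_filter; apply: (perm_big _).
apply: uniq_perm.
- by rewrite filter_uniq // map_inj_uniq ?enum_uniq //; apply: val_inj.
- exact: filter_uniq.
move=> s; rewrite !mem_filter; case: (eqVneq (sumn s) n) => [sn|sn].
  rewrite lP //= andbC; congr (_ && _); apply/mapP/idP => [[p _ ->]|sp].
    exact: intpartP.
  by exists (IntPart sp); rewrite ?mem_enum.
apply/negP => /andP[_ /mapP[p _ sE]]; case/eqP: sn; rewrite sE.
by have /and3P[_ _ /eqP] := intpartP p.
Qed.

Section MultLists.
Variables (a : pred nat) (n : nat).

(** The partitions into parts at most M that satisfy a, each part occurring at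
most n times: a finite family that is large enough for the coefficient of
q^n. *)
Fixpoint partition_lists (M : nat) : seq (seq nat) :=
  if M is m.+1 then
    if a M then [seq nseq j M ++ s | j <- iota 0 n.+1, s <- partition_lists m]
    else partition_lists m
  else [:: [::]].

Lemma partition_listsS M : partition_lists M.+1 =
  if a M.+1 then [seq nseq j M.+1 ++ s | j <- iota 0 n.+1, s <- partition_lists M]
  else partition_lists M.
Proof. by []. Qed.

Lemma partition_lists_parts M s : s \in partition_lists M ->
  sorted geq s && all (fun i => (0 < i <= M) && a i) s.
Proof.
elim: M s => [|M IH] s; first by rewrite inE => /eqP->.
rewrite partition_listsS.
have weak t : all (fun i => (0 < i <= M) && a i) t ->
    all (fun i => (0 < i <= M.+1) && a i) t.
  by apply: sub_all => i /andP[/andP[-> /leqW ->] ->].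
case: ifP => aM; last by move=> /IH/andP[-> /weak].
move=> /allpairsP[[j t] /= [_ /IH/andP[st at_] ->]].
rewrite all_cat (weak _ at_) andbT; apply/andP; split; last first.
  by apply/allP => i /nseqP[-> _]; rewrite leqnn aM.
elim: j => //= j; case: j => [|j] /=; last by rewrite leqnn.
move=> _; case: t st at_ => //= y t -> /andP[/andP[/andP[_ yM] _] _].
by rewrite andbT ltnW.
Qed.

Lemma mem_partition_lists M s : sorted geq s ->
  all (fun i => (0 < i <= M) && a i) s -> size s <= n -> s \in partition_lists M.
Proof.
elim: M s => [|M IH] s ss al sz.
  by case: s al {ss sz} => // i s /= /andP[/andP[/andP[i0 iM] _] _]; lia.
rewrite partition_listsS.
have [j [t [sE tM]]] : exists j t, s = nseq j M.+1 ++ t /\ all (fun i => i <= M) t.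
  elim: s ss al {sz} => [|x s IHs] /= ss; first by exists 0, [::].
  case/andP=> /andP[/andP[_ xM] _] al.
  case: (ltngtP x M.+1) xM => // [xM|->] _.
    exists 0, (x :: s); split=> //=; rewrite -ltnS xM /=.
    have geq_trans : transitive geq by move=> y z t /=; rewrite /geq /=; lia.
    by apply: sub_all (order_path_min geq_trans ss) => y; rewrite /geq /=; lia.
  have [j [t [-> tM]]] := IHs (path_sorted ss) al.
  by exists j.+1, t.
have at_ : all (fun i => (0 < i <= M) && a i) t.
  move: al; rewrite sE all_cat => /andP[_ al].
  apply/allP => i it; have := allP al _ it; have := allP tM _ it.
  by move=> -> /andP[/andP[-> _] ->].
have st : sorted geq t.
  move: ss; rewrite sE; apply: subseq_sorted (suffix_subseq _ _).
  by move=> y z u /=; rewrite /geq /=; lia.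
move: sz; rewrite sE size_cat size_nseq => sz.
have tin : t \in partition_lists M by apply: IH; lia.
case: ifP => aM.
  by apply/allpairsP; exists (j, t); rewrite mem_iota; split=> //=; lia.
case: j sE {sz} => [|j] sE //; move: al; rewrite sE /= aM.
by rewrite andbF.
Qed.

Lemma partition_lists_uniq M : uniq (partition_lists M).
Proof.
elim: M => // M IH; rewrite partition_listsS; case: ifP => // aM.
apply: allpairs_uniq => //.
  exact: iota_uniq.
move=> [j s] [k t] js kt.
have sM : s \in partition_lists M by case/allpairsPdep: js => [? [? [_ ? [_ ->]]]].
have tM : t \in partition_lists M by case/allpairsPdep: kt => [? [? [_ ? [_ ->]]]].
have notin u : u \in partition_lists M -> count_mem M.+1 u = 0.
  move=> /partition_lists_parts/andP[_ al]; apply/count_memPn/negP => /(allP al).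
  by rewrite ltnn andbF.
move=> E; have := congr1 (count_mem M.+1) E.
rewrite !count_cat !count_nseq /= eqxx !mul1n !notin // !addn0 => jk.
by move: E; rewrite jk => /eqP; rewrite eqseq_cat ?size_nseq // => /andP[_ /eqP->].
Qed.

Local Open Scope ring_scope.

Lemma partition_lists_gf (R : comNzRingType) (q : R) M :
  \sum_(s <- partition_lists M) q ^+ sumn s
  = \prod_(i < M) (if a i.+1 then geom n (q ^+ i.+1) else 1).
Proof.
elim: M => [|M IH]; first by rewrite big_seq1 big_ord0.
rewrite big_ord_recr -IH partition_listsS [RHS]/=.
case: ifP => _; last by rewrite mulr1.
rewrite big_allpairs_dep /geom mulrC mulr_suml.
rewrite -(big_mkord xpredT (fun t => q ^+ M.+1 ^+ t * _)).
rewrite /index_iota subn0; apply: eq_bigr => j _; rewrite mulr_sumr.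
by apply: eq_bigr => s _; rewrite sumn_cat sumn_nseq exprD exprM.
Qed.
End MultLists.

(* The ring Z[X]/(X^(n+1)) and the nilpotent element q = X. *)
Section Truncation.
Local Open Scope ring_scope.
Variable n : nat.
Let h : {poly int} := 'X^(n.+1).

Lemma truncX_nil : (in_qpoly h 'X) ^+ n.+1 = 0.
Proof.
rewrite -rmorphXn; apply/val_inj; rewrite /= mk_monic_Xn.
exact: (Pdiv.RingMonic.rmodpp (monicXn _ _)).
Qed.

Lemma trunc_coef (A B : {poly int}) : in_qpoly h A = in_qpoly h B -> A`_n = B`_n.
Proof.
move=> /(congr1 val) /=; rewrite mk_monic_Xn /= -!Pdiv.RingMonic.take_poly_rmodp.
by move=> /(congr1 (fun p : {poly int} => p`_n)); rewrite !coef_take_poly ltnSn.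
Qed.

Lemma coef_gf (l : seq (seq nat)) (w : seq nat -> nat) :
  (\sum_(s <- l) (w s)%:R * 'X^(sumn s) : {poly int})`_n
  = (\sum_(s <- l | sumn s == n) w s)%N%:R.
Proof.
rewrite coef_sum natr_sum [RHS]big_mkcond; apply: eq_bigr => s _.
rewrite mulr_natl coefMn coefXn eq_sym; case: eqP => _; rewrite ?mul0rn ?mulr0n //.
Qed.

Lemma gf_eq_coef (l1 l2 : seq (seq nat)) (w1 w2 : seq nat -> nat) :
  let q := in_qpoly h 'X in
  \sum_(s <- l1) (w1 s)%:R * q ^+ sumn s
  = \sum_(s <- l2) (w2 s)%:R * q ^+ sumn s ->
  (\sum_(s <- l1 | sumn s == n) w1 s = \sum_(s <- l2 | sumn s == n) w2 s)%N.
Proof.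
move=> q E; have := trunc_coef (A := \sum_(s <- l1) (w1 s)%:R * 'X^(sumn s))
   (B := \sum_(s <- l2) (w2 s)%:R * 'X^(sumn s)).
rewrite !coef_gf => /(_ _)/eqP; rewrite eqr_nat => H; apply/eqP/H.
rewrite !rmorph_sum; move: E; rewrite /q.
under eq_bigr do rewrite -rmorphXn -(rmorph_nat (in_qpoly h)) -rmorphM.
by under [X in _ = X -> _]eq_bigr do
  rewrite -rmorphXn -(rmorph_nat (in_qpoly h)) -rmorphM.
Qed.
End Truncation.

Definition staircases n V : seq (seq nat) :=
  [seq stair s | N <- iota 0 n.+1, s <- bounded_lists N V].

Lemma staircases_uniq n V : uniq (staircases n V).
Proof.
apply: allpairs_uniq_dep => [|N _|]; rewrite ?iota_uniq ?bounded_lists_uniq //.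
move=> [N s] [M t] sN tM /= /(can_inj stairK) E.
have size_tag (u : {_ : nat & seq nat}) :
    u \in [seq Tagged (fun=> seq nat) (i := K) v |
            K <- iota 0 n.+1, v <- bounded_lists K V] ->
    size (tagged u) = tag u.
  move=> /allpairsPdep[K [v [_ vK ->]]].
  by move: vK; rewrite mem_bounded_lists => /andP[/eqP].
by have := size_tag _ sN; have := size_tag _ tM; rewrite /= E => -> ->.
Qed.

Lemma mem_staircases n V s : n <= V -> sumn s = n ->
  (s \in staircases n V) = sorted gap2 s && all (leq 1) s.
Proof.
move=> nV sn; apply/allpairsPdep/andP => [[N [t [_ tV ->]]]|[ss sp]].
  move: tV; rewrite mem_bounded_lists => /andP[_ pt].
  by rewrite stair_sorted stair_pos (path_sorted pt).
have sE := unstairK ss sp; exists (size (unstair s)), (unstair s).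
have sum : size (unstair s) * size (unstair s) + sumn (unstair s) = n.
  by rewrite -sumn_stair sE.
rewrite sE mem_iota mem_bounded_lists eqxx /=; split=> //; first by nia.
have : sorted geq (unstair s) by rewrite -stair_sorted sE.
case: (unstair s) sum => //= x u sum ->; rewrite andbT /geq /=; lia.
Qed.

Section Final.
Local Open Scope ring_scope.
Variables (R : comNzRingType) (n : nat) (q : R).
Hypothesis qn : q ^+ n.+1 = 0.

Lemma qbin_limit k l : (n <= l)%N -> qbin q (k + l) k = inv_qfact n q k.
Proof.
move=> nl; have eS := inv_qfactS qn; have e0 := inv_qfact0 n q.
apply: (mulr_e_inj e0 eS (m := n)) => /=.
have := qbin_quotient e0 eS k l.
by rewrite (inv_qfact_stable qn nl) (@inv_qfact_stable _ _ q (k + l) qn) //; lia.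
Qed.

(** The bound V = 3 n on the values makes every Gaussian binomial equal to its
limit: for a set of t <= n values this needs V - 2 t >= n. *)
Lemma staircases_gf :
  \sum_(s <- staircases n (3 * n)) (nmarkings s)%:R * q ^+ sumn s
  = \sum_(N < n.+1) q ^+ (N * N) *
     (\sum_(t < N.+1) q ^+ (t * t + t) * inv_qfact n q (N - t) * inv_qfact n q t).
Proof.
rewrite /staircases big_allpairs_dep -[iota 0 n.+1]/(index_iota 0 n.+1) big_mkord.
apply: eq_bigr => N _; have Nn : (N <= n)%N by rewrite -ltnS.
transitivity (q ^+ (N * N) * markings_gf q N (3 * n)).
  rewrite /markings_gf mulr_sumr; apply: (eq_big_seq _) => s.
  rewrite mem_bounded_lists => /andP[/eqP sN _].
  by rewrite sumn_stair sN exprD mulrCA.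
have [-> _ _] := markings_gfE q N; congr (_ * _); apply: eq_bigr => t _.
have tN : (t <= N)%N by rewrite -ltnS.
rewrite /sparse_gf /multiset_gf qbin_limit; last by lia.
have -> : (3 * n - t = t + (3 * n - t - t))%N by lia.
rewrite qbin_limit; last by lia.
by rewrite mulrAC.
Qed.
End Final.

Lemma A72E n : A72 n =
  \sum_(s <- partition_lists allowed7 n (7 * n.*2) | sumn s == n) 1.
Proof.
rewrite -(sum_intpart (a := all allowed7) (fun=> 1)) ?partition_lists_uniq //.
  by rewrite /A72 -sum1dep_card.
move=> s sn; rewrite /is_intpart sn eqxx andbT; apply/idP/idP.
  move=> /partition_lists_parts/andP[-> al] /=; rewrite -all_predI.
  by apply: sub_all al => i /andP[/andP[i0 _] ai] /=; rewrite i0.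
case/andP=> /andP[ss pos] al; apply: mem_partition_lists => //.
  apply/allP => i si; rewrite (allP al _ si) (allP pos _ si) andbT /=.
  by have := leq_sumn_mem si; rewrite sn; lia.
rewrite -sn; elim: s pos {sn ss al} => //= i s IH /andP[i0 /IH]; lia.
Qed.

Lemma weighted_sumE n : \sum_(p : intpart n | inR p) weight6 p
  = \sum_(s <- staircases n (3 * n) | sumn s == n) nmarkings s.
Proof.
rewrite -(sum_intpart (a := inR) nmarkings) ?staircases_uniq //.
  apply: eq_bigr => p; rewrite inRE => Rp; apply: weight6_nmarkings => //.
  by have /and3P[] := intpartP p.
move=> s sn; rewrite mem_staircases //; last by lia.
rewrite /is_intpart sn eqxx andbT inRE andbC.
case Rs: (sorted gap2 s); rewrite ?andbF //.
rewrite !andbT; suff -> : sorted geq s by [].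
by apply: sub_sorted Rs => x y; rewrite /gap2 /geq /=; lia.
Qed.

Theorem theorem6 (n : nat) :
  A72 n = \sum_(p : intpart n | inR p) weight6 p.
Proof.
rewrite weighted_sumE A72E; apply: gf_eq_coef; set q := in_qpoly _ 'X.
have qn : (q ^+ n.+1 = 0)%R by apply: truncX_nil.
rewrite (staircases_gf qn) (andrews_gordon_product qn) -partition_lists_gf.
by apply: eq_bigr => s _; rewrite mul1r.
Qed.
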